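(* Let $X,Y$ be real locally convex topological vector spaces, let $f\colon X\to(-\infty,\infty]$ and $g\colon Y\to(-\infty,\infty]$ be proper convex functions, and let $A\colon X\to Y$ be a continuous linear operator. Define $$\hat p:=\inf_{x\in X}\{f(x)+g(Ax)\},\qquad \hat d:=\sup_{y^*\in Y^*}\{-f^*(A^*y^* )-g^*(-y^* )\}.$$ Suppose that $g$ is polyhedral and that $\mathrm{dom}(g\circ A)\cap\mathrm{qri}(\mathrm{dom}(f))\neq\emptyset$. Then $\hat p=\hat d$. Furthermore, if $\hat p$ is finite, then the supremum in the definition of $\hat d$ is attained.
   Context: $A^*\colon Y^*\to X^*$ is the adjoint of $A$. For an extended-real-valued function $h$, $\mathrm{dom}(h)$ is the set of points where $h<\infty$. The Fenchel conjugate of $h\colon X\to(-\infty,\infty]$ is $h^*(x^* ):=\sup\{\langle x^*,x\rangle-h(x)\mid x\in X\}$, $x^*\in X^*$ (similarly on $Y$). A subset $P$ of a locally convex space $Z$ is a convex polyhedron if $P=\{z\in Z\mid\langle z_i^*,z\rangle\le\alpha_i,\ i=1,\dots,k\}$ for finitely many $z_i^*\in Z^*$, $\alpha_i\in\mathbb{R}$; $g$ is polyhedral if $\mathrm{epi}(g):=\{(y,\lambda)\in Y\times\mathbb{R}\mid g(y)\le\lambda\}$ is a convex polyhedron in $Y\times\mathbb{R}$. For a convex set $\Omega$, $\mathrm{qri}(\Omega):=\{x\in\Omega\mid\overline{\mathrm{cone}(\Omega-x)}\text{ is a linear subspace}\}$, where $\mathrm{cone}(A):=\{ta\mid t\ge0,\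 a\in A\}$. *)

(* Defs.v *)
From HB Require Import structures.
From mathcomp Require Import all_boot all_order all_algebra.
From mathcomp Require Import all_classical all_reals.
From mathcomp Require Import ereal topology normedtype.

Set Implicit Arguments.
Unset Strict Implicit.
Unset Printing Implicit Defensive.

Import Order.TTheory GRing.Theory Num.Theory.
Import numFieldNormedType.Exports.

Local Open Scope classical_set_scope.
Local Open Scope ring_scope.

(* The library has no bundled continuous linear maps between locally convex
   spaces; this is the join of its classes of linear and continuous functions. *)
#[short(type="linContType")]
HB.structure Definition LinearContinuous (R : numFieldType) (E F : tvsType R) :=
  {h of @isContinuous E F h & @GRing.Linear R E F *:%R h}.

Notation dual E := (linContType E (_^o)).

Section dual_operations.
Variables (R : numFieldType) (E F : tvsType R).

Lemma dual_opp_continuous (u : dual E) : continuous (\- u : E -> R^o).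
Proof. by move=> x; apply: cvgN; exact: cts_fun. Qed.

HB.instance Definition _ (u : dual E) :=
  isContinuous.Build E R^o (\- u : E -> R^o) (@dual_opp_continuous u).

Definition dual_opp (u : dual E) : dual E := (\- u : E -> R^o).

HB.instance Definition _ (A : linContType E F) (v : dual F) :=
  Continuous.on (v \o A : E -> R^o).

Definition adjoint (A : linContType E F) (v : dual F) : dual E := v \o A.

End dual_operations.

Section convex_analysis.
Variables (R : realType) (E : tvsType R).
Implicit Types (h : E -> \bar R) (D : set E).

Local Open Scope ereal_scope.

Definition edom h : set E := [set x | h x < +oo].

Definition eproper h := (forall x, h x != -oo) /\ edom h !=set0.

(* Meant for h not taking the value -oo, so that the right-hand side is never
   of the form oo - oo; the endpoints t = 0, 1 rely on 0 * +oo = 0. *)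
Definition econvex h := forall (x y : E) (t : R), (0 <= t <= 1)%R ->
  h (t *: x + (1 - t) *: y)%R <= t%:E * h x + (1 - t)%:E * h y.

Definition epi h : set (E * R^o) := [set z | h z.1 <= (z.2 : R)%:E].

Definition conjugate h (u : dual E) : \bar R :=
  ereal_sup [set (u x : R)%:E - h x | x in [set: E]].

Definition cone D : set E :=
  [set (t *: a)%R | t in [set t : R | (0 <= t)%R] & a in D].

Definition linear_subspace D := submod_closed [pred x : E | x \in D].

Definition qri D : set E :=
  [set x | D x /\ linear_subspace (closure (cone [set (a - x)%R | a in D]))].

Definition polyhedron D :=
  exists (k : nat) (z : 'I_k -> dual E) (alpha : 'I_k -> R),
    D = [set x | forall i, ((z i x : R) <= alpha i)%R].

End convex_analysis.

Definition polyhedral (R : realType) (E : tvsType R) (h : E -> \bar R) :=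
  polyhedron (epi h).

Section duality.
Variables (R : realType) (X Y : tvsType R).
Variables (f : X -> \bar R) (g : Y -> \bar R) (A : linContType X Y).

Local Open Scope ereal_scope.

Definition primal_value : \bar R :=
  ereal_inf [set f x + g (A x) | x in [set: X]].

(* Both terms are < +oo when f and g are proper, so no oo - oo arises. *)
Definition dual_objective (v : dual Y) : \bar R :=
  - conjugate f (adjoint A v) - conjugate g (dual_opp v).

Definition dual_value : \bar R :=
  ereal_sup [set dual_objective v | v in [set: dual Y]].

End duality.

(* Main.v *)
Require Import Defs.
From HB Require Import structures.
From mathcomp Require Import all_boot all_order all_algebra.
From mathcomp Require Import all_classical all_reals.
From mathcomp Require Import ereal topology normedtype.
From mathcomp Require Import ring lra.

Set Implicit Arguments.
Unset Strict Implicit.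
Unset Printing Implicit Defensive.

Import Order.TTheory GRing.Theory Num.Theory.
Import numFieldNormedType.Exports.

Local Open Scope classical_set_scope.
Local Open Scope ring_scope.

(** Weak duality is the Fenchel-Young inequality, and the qualification makes the
primal value smaller than +oo, so the content is the case of a finite primal
value p. Writing epi g as a finite system z_i (y, r) <= alpha_i turns the primal
problem into the convex program of minimizing f x + r over dom f * R under the
finitely many affine constraints z_i (A x, r) - alpha_i <= 0. Lagrange
multipliers mu >= 0 for this program give a dual solution: letting r vary forces
\sum_i mu_i z_i (y, r) = u y - r for some u in the dual of Y, and then - u
attains p, since the Lagrangian inequality bounds f^* (- A^* u) and the
description of epi g bounds g^* u (lemma [dual_attained]).

The multipliers ([lagrange_multipliers]) are obtained without any topology or
separation theorem in X. All that is used of the reference point x0 is that it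
is not a support point of the domain C for the span of the constraints: a
combination of the constraints that is minimal over C at x0 is constant on C.
A point of qri C has this property because a continuous functional that is
nonnegative on cone (C - x0) is nonnegative on its closure, which is a linear
subspace, hence vanishes there ([qri_no_support]).

The constraints are dualized one at a time, by induction on their number. If
some point satisfying the other constraints satisfies the first one, c0 <= 0,
strictly, a single real number is to be found, which is the supremum of slopes
([two_sided_multiplier]), and the remaining constraints are handled by
induction. Otherwise c0 >= 0 wherever the other constraints hold, and the
induction hypothesis for the objective c0 gives nu >= 0 with
c0 + \sum_i nu_i c_i >= 0 on C; no term of this combination is positive at x0,
so it vanishes there, hence on C.
The induction hypothesis on C /\ [c0 = 0] then gives nonnegative multipliers
for the other constraints, the equation c0 = 0 is dualized with a multiplier of
arbitrary sign, and adding a multiple of the combination c0 + \sum_i nu_i c_i,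
which is zero on C, makes that multiplier nonnegative. *)

(** * Lagrange multipliers for affine constraints *)
Section lagrange.
Variables (R : realType) (V : lmodType R).
Implicit Types (C : set V) (F G h : V -> R) (x y : V) (p t m : R) (k : nat).

(** F is constrained on C only, so that it may stand for the finite part of an
extended-real-valued function of domain C. *)
Definition convex_on C F := forall x y t, 0 <= t <= 1 -> C x -> C y ->
  C (t *: x + (1 - t) *: y) /\
  F (t *: x + (1 - t) *: y) <= t * F x + (1 - t) * F y.

Definition affine h := forall x y t,
  h (t *: x + (1 - t) *: y) = t * h x + (1 - t) * h y.

Definition combination k (nu : 'I_k -> R) (c : 'I_k -> V -> R) x : R :=
  \sum_i nu i * c i x.

(** The algebraic trace of quasi-relative interiority: no hyperplane from the
span of the family c supports C at x0 unless it contains C. *)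
Definition no_support C x0 k (c : 'I_k -> V -> R) := forall nu,
  (forall x, C x -> combination nu c x0 <= combination nu c x) ->
  forall x, C x -> combination nu c x = combination nu c x0.

Definition cons_fam k (a : R) (nu : 'I_k -> R) (i : 'I_k.+1) : R :=
  oapp nu a (unlift ord0 i).

Definition tail_fam k (c : 'I_k.+1 -> V -> R) (i : 'I_k) : V -> R :=
  c (lift ord0 i).

Lemma combination_cons k a (nu : 'I_k -> R) c x :
  combination (cons_fam a nu) c x =
  a * c ord0 x + combination nu (tail_fam c) x.
Proof.
rewrite /combination big_ord_recl /cons_fam unlift_none; congr (_ + _).
by apply: eq_bigr => i _; rewrite liftK.
Qed.

Lemma cons_fam_ge0 k a (nu : 'I_k -> R) :
  0 <= a -> (forall i, 0 <= nu i) -> forall i, 0 <= cons_fam a nu i.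
Proof. by move=> a0 nu0 i; rewrite /cons_fam; case: unliftP => [j|] _ /=. Qed.

Lemma combination_affine k nu (c : 'I_k -> V -> R) :
  (forall i, affine (c i)) -> affine (combination nu c).
Proof.
move=> aff x y t; rewrite /combination !mulr_sumr -big_split /=.
by apply: eq_bigr => i _; rewrite aff; ring.
Qed.

Lemma convex_onD C F h : convex_on C F -> affine h ->
  convex_on C (fun x => F x + h x).
Proof.
move=> cF aff x y t t01 Cx Cy; have [Cz Fz] := cF x y t t01 Cx Cy.
by split => //; rewrite aff; lra.
Qed.

Lemma convex_on_affine C F h : convex_on C F -> affine h -> convex_on C h.
Proof.
by move=> cF aff x y t t01 Cx Cy; have [] := cF x y t t01 Cx Cy; rewrite aff.
Qed.

Lemma affineMl m h : affine h -> affine (fun x => m * h x).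
Proof. by move=> aff x y t; rewrite aff; ring. Qed.

Lemma convex_on_zero C F h : convex_on C F -> affine h ->
  convex_on (C `&` [set x | h x = 0]) F.
Proof.
move=> cF aff x y t t01 [Cx /= hx] [Cy hy]; have [Cz Fz] := cF x y t t01 Cx Cy.
by split=> //; split=> //=; rewrite aff hx hy; ring.
Qed.

Lemma convex_on_sublevel C F k (c : 'I_k -> V -> R) : convex_on C F ->
  (forall i, affine (c i)) ->
  convex_on (C `&` [set x | forall i, c i x <= 0]) F.
Proof.
move=> cF aff x y t /andP[t0 t1] [Cx /= cx] [Cy cy].
have [|Cz Fz] := cF x y t _ Cx Cy; first by rewrite t0.
split=> //; split=> //= i; rewrite aff.
by have := cx i; have := cy i; nra.
Qed.

(** The multiplier m must dominate (p - G x) / h x where h > 0 and be dominated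
by (G y - p) / - h y where h < 0. Each of the first numbers is at most each of
the second, since the segment [x, y] meets h = 0, where p <= G. *)
Lemma two_sided_multiplier C G h p v w :
  convex_on C G -> affine h -> C v -> h v < 0 -> C w -> 0 < h w ->
  (forall x, C x -> h x = 0 -> p <= G x) ->
  exists m, forall x, C x -> p <= G x + m * h x.
Proof.
move=> cG aff Cv hv Cw hw pG.
pose S := [set (p - G x) / h x | x in C `&` [set x | 0 < h x]].
have S_le y : C y -> h y < 0 -> ubound S ((G y - p) / - h y).
  move=> Cy hy _ [x [Cx /= hx] <-].
  (* the weight of the point of the segment where h vanishes *)
  pose t := - h y / (h x - h y).
  have d0 : 0 < h x - h y by lra.
  have t01 : 0 <= t <= 1.
    apply/andP; split; first by rewrite divr_ge0; lra.
    by rewrite ler_pdivrMr; lra.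
  have [Cz Gz] := cG x y t t01 Cx Cy.
  have hz : h (t *: x + (1 - t) *: y) = 0.
    by rewrite aff /t; field; rewrite gt_eqF.
  have pz := le_trans (pG _ Cz hz) Gz.
  have {}pz : p * (h x - h y) <= - h y * G x + h x * G y.
    have -> : - h y * G x + h x * G y = (t * G x + (1 - t) * G y) * (h x - h y).
      by rewrite /t; field; rewrite gt_eqF.
    by rewrite ler_pM2r.
  by rewrite ler_pdivrMr // mulrAC ler_pdivlMr; lra.
have S0 : S !=set0 by exists ((p - G w) / h w), w.
have Sb : has_sup S by split=> //; exists ((G v - p) / - h v); exact: S_le.
exists (sup S) => x Cx; have [hx|hx|hx] := ltgtP (h x) 0.
- have := ge_sup S0 (S_le x Cx hx); rewrite ler_pdivlMr; lra.
- have /(ub_le_sup Sb.2) : S ((p - G x) / h x) by exists x.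
  by rewrite ler_pdivrMr; lra.
- by rewrite hx mulr0 addr0 pG.
Qed.

(** When h takes only one sign on C it vanishes on C, and then any multiplier
works; otherwise h takes both signs and the slope argument applies. *)
Lemma equality_multiplier C G h x0 p :
  convex_on C G -> affine h -> C x0 -> h x0 = 0 ->
  ((forall x, C x -> 0 <= h x) -> forall x, C x -> h x = 0) ->
  ((forall x, C x -> h x <= 0) -> forall x, C x -> h x = 0) ->
  (forall x, C x -> h x = 0 -> p <= G x) ->
  exists m, forall x, C x -> p <= G x + m * h x.
Proof.
move=> cG aff Cx0 hx0 hge hle pG.
have hconst : (forall x, C x -> h x = 0) ->
    exists m, forall x, C x -> p <= G x + m * h x.
  by move=> h0; exists 0 => x Cx; rewrite mul0r addr0 pG // h0.
have [[v [Cv hv]]|noleft] := pselect (exists v, C v /\ h v < 0); last first.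
  apply/hconst/hge => x Cx; rewrite leNgt; apply/negP => hx.
  by apply: noleft; exists x.
have [[w [Cw hw]]|noright] := pselect (exists w, C w /\ 0 < h w); last first.
  apply/hconst/hle => x Cx; rewrite leNgt; apply/negP => hx.
  by apply: noright; exists x.
exact: (two_sided_multiplier cG aff Cv hv Cw hw).
Qed.

(** An inequality constraint admits the multiplier 0 whenever it admits a negative
one. *)
Lemma slater_multiplier C G h p v :
  convex_on C G -> affine h -> C v -> h v < 0 ->
  (forall x, C x -> h x <= 0 -> p <= G x) ->
  exists2 m, 0 <= m & forall x, C x -> p <= G x + m * h x.
Proof.
move=> cG aff Cv hv pG.
have [[w [Cw hw]]|noright] := pselect (exists w, C w /\ 0 < h w); last first.
  exists 0 => // x Cx; rewrite mul0r addr0 pG // leNgt; apply/negP => hx.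
  by apply: noright; exists x.
have [|m pm] := two_sided_multiplier (p := p) cG aff Cv hv Cw hw.
  by move=> x Cx hx; rewrite pG ?hx.
have [m0|m0] := leP 0 m; first by exists m.
exists 0 => // x Cx; rewrite mul0r addr0.
have [hx|hx] := leP (h x) 0; first exact: pG.
by have := pm x Cx; nra.
Qed.

Lemma no_support_tail C x0 k (c : 'I_k.+1 -> V -> R) :
  no_support C x0 c -> no_support C x0 (tail_fam c).
Proof.
move=> ns nu; have := ns (cons_fam 0 nu).
have e x : combination (cons_fam 0 nu) c x = combination nu (tail_fam c) x.
  by rewrite combination_cons mul0r add0r.
move=> {}ns le x Cx; have := ns _ x Cx; rewrite !e; apply => y Cy.
by rewrite !e le.
Qed.

Lemma combination_const0 k (c : 'I_k -> V -> R) x : 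
  combination (fun=> 0) c x = 0.
Proof. by rewrite /combination big1 // => i _; rewrite mul0r. Qed.

Lemma no_support_head C x0 k (c : 'I_k.+1 -> V -> R) m :
  no_support C x0 c -> c ord0 x0 = 0 ->
  (forall x, C x -> 0 <= m * c ord0 x) -> forall x, C x -> m * c ord0 x = 0.
Proof.
move=> ns c0 le x Cx.
have e y : combination (cons_fam m (fun=> 0)) c y = m * c ord0 y.
  by rewrite combination_cons combination_const0 addr0.
have := ns (cons_fam m (fun=> 0)) _ x Cx; rewrite !e c0 mulr0; apply => y Cy.
by rewrite e le.
Qed.

(** An affine equation that holds at a non-support point can be dualized, with a
multiplier of arbitrary sign. *)
Lemma head_multiplier C G x0 k (c : 'I_k.+1 -> V -> R) p :
  convex_on C G -> affine (c ord0) -> C x0 -> c ord0 x0 = 0 ->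
  no_support C x0 c ->
  (forall x, C x -> c ord0 x = 0 -> p <= G x) ->
  exists m, forall x, C x -> p <= G x + m * c ord0 x.
Proof.
move=> cG aff Cx0 c0 ns; apply: (equality_multiplier cG aff Cx0 c0).
- move=> ge x Cx; rewrite -[LHS]mul1r; apply: (no_support_head ns c0 _ Cx).
  by move=> y Cy; rewrite mul1r ge.
- move=> le x Cx; apply: oppr_inj; rewrite oppr0 -[LHS]mulN1r.
  by apply: (no_support_head ns c0 _ Cx) => y Cy; rewrite mulN1r oppr_ge0 le.
Qed.

(** Cutting C by one of the hyperplanes preserves non-support: a combination of
the other functions which is minimal at x0 over the cut has, by dualizing the
equation of the cut, a perturbation by a multiple of that equation which is
minimal at x0 over the whole of C. *)
Lemma no_support_zero C F x0 k (c : 'I_k.+1 -> V -> R) :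
  convex_on C F -> (forall i, affine (c i)) -> C x0 -> c ord0 x0 = 0 ->
  no_support C x0 c ->
  no_support (C `&` [set x | c ord0 x = 0]) x0 (tail_fam c).
Proof.
move=> cF aff Cx0 c0 ns nu le x [Cx /= cx].
have cT : convex_on C (combination nu (tail_fam c)).
  by apply: (convex_on_affine cF); apply: combination_affine => i; exact: aff.
have [y Cy cy|m mP] := head_multiplier (p := combination nu (tail_fam c) x0)
  cT (aff ord0) Cx0 c0 ns; first exact: le.
have := ns (cons_fam m nu) _ x Cx.
rewrite !combination_cons c0 cx !mulr0 !add0r; apply => y Cy.
by rewrite combination_cons addrC mP.
Qed.

(** Strong duality under a Slater-type condition in which x0 need not satisfy the
affine constraints strictly. *)
Theorem lagrange_multipliers k (c : 'I_k -> V -> R) C F x0 p :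
  convex_on C F -> (forall i, affine (c i)) ->
  C x0 -> (forall i, c i x0 <= 0) -> no_support C x0 c ->
  (forall x, C x -> (forall i, c i x <= 0) -> p <= F x) ->
  exists2 mu : 'I_k -> R, (forall i, 0 <= mu i) &
    forall x, C x -> p <= F x + combination mu c x.
Proof.
elim: k => [|k IH] in c C F p *.
  move=> cF aff Cx0 c0 ns pF; exists (fun=> 0) => // x Cx.
  by rewrite combination_const0 addr0 pF // => -[].
move=> cF aff Cx0 cx0 ns pF.
have aff' i : affine (tail_fam c i) by exact: aff.
have cx0' i : tail_fam c i x0 <= 0 by exact: cx0.
have split_c x : c ord0 x <= 0 -> (forall i, tail_fam c i x <= 0) ->
    forall i, c i x <= 0.
  by move=> ? ct i; case: (unliftP ord0 i) => [j|] ->; [exact: ct|].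
pose D := C `&` [set x | forall i, tail_fam c i x <= 0].
(* first case: c0 < 0 somewhere under the other constraints *)
have [[v [Dv cv]]|noslater] := pselect (exists v, D v /\ c ord0 v < 0).
  have [|m m0 pm] := slater_multiplier (p := p)
      (convex_on_sublevel cF aff') (aff ord0) Dv cv.
    by move=> x [Cx cx] ?; apply: pF => //; exact: split_c.
  have cG := convex_onD cF (affineMl m (aff ord0)).
  have [|mu mu0 pmu] := IH _ _ _ p cG aff' Cx0 cx0' (no_support_tail ns).
    by move=> x Cx cx; apply: pm.
  exists (cons_fam m mu); first exact: cons_fam_ge0.
  by move=> x Cx; rewrite combination_cons addrA pmu.
(* second case: c0 >= 0 under the other constraints, so that minimizing c0 is a
   program with one constraint less, of value 0 at x0 *)
have Dge x : D x -> 0 <= c ord0 x.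
  by move=> Dx; rewrite leNgt; apply/negP => ?; apply: noslater; exists x.
have c0 : c ord0 x0 = 0 by apply/le_anti; rewrite cx0 Dge.
have [|nu nu0 nuP] := IH _ _ _ 0 (convex_on_affine cF (aff ord0)) aff' Cx0 cx0'
    (no_support_tail ns); first by move=> x Cx cx; apply: Dge.
have e x : combination (cons_fam 1 nu) c x =
    c ord0 x + combination nu (tail_fam c) x.
  by rewrite combination_cons mul1r.
have nux0 : combination nu (tail_fam c) x0 = 0.
  apply/le_anti/andP; split; last by have := nuP x0 Cx0; rewrite c0 add0r.
  by apply: sumr_le0 => i _; rewrite mulr_ge0_le0.
(* nonnegative on C and zero at x0: this combination is zero on C *)
have dep x : C x -> c ord0 x + combination nu (tail_fam c) x = 0.
  move=> Cx; have := ns (cons_fam 1 nu) _ x Cx.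
  rewrite !e c0 nux0 addr0; apply => y Cy.
  by rewrite e nuP.
have [|mu mu0 muP] := IH _ _ _ p (convex_on_zero cF (aff ord0)) aff'
    (conj Cx0 c0) cx0' (no_support_zero cF aff Cx0 c0 ns).
  by move=> x [Cx /= cx] ct; apply: pF => //; apply: split_c; rewrite ?cx.
(* the multiplier m of the equation c0 = 0 may be negative *)
have [|m mP] := head_multiplier (p := p)
    (convex_onD cF (combination_affine mu aff')) (aff ord0) Cx0 c0 ns.
  by move=> x Cx cx; apply: muP.
(* s copies of the vanishing combination make it nonnegative *)
pose s := Num.max 0 (- m).
exists (cons_fam (m + s) (fun i => mu i + s * nu i)).
  apply: cons_fam_ge0 => [|i].
    by rewrite -lerBlDl sub0r le_max lexx orbT.
  by rewrite addr_ge0 // mulr_ge0 // le_max lexx.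
move=> x Cx; rewrite combination_cons.
have -> : combination (fun i => mu i + s * nu i) (tail_fam c) x =
    combination mu (tail_fam c) x + s * combination nu (tail_fam c) x.
  rewrite /combination mulr_sumr -big_split; apply: eq_bigr => i _ /=; ring.
have := mP x Cx; have := dep x Cx => {}e.
have -> : combination nu (tail_fam c) x = - c ord0 x by lra.
by move=> ?; lra.
Qed.

End lagrange.

(** * Functionals on products and quasi-relative interiors *)

Section dual_constructions.
Variables (R : realType) (E : tvsType R).

Definition dual_sum k (nu : 'I_k -> R) (z : 'I_k -> dual E) : E -> R^o :=
  fun x => \sum_i nu i * z i x.

Fact dual_sum_linear k nu (z : 'I_k -> dual E) : linear (dual_sum nu z).
Proof.
move=> a x y; rewrite /dual_sum scaler_sumr -big_split /=.
by apply: eq_bigr => i _; rewrite linearP mulrDr mulrCA.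
Qed.

Fact dual_sum_continuous k nu (z : 'I_k -> dual E) : continuous (dual_sum nu z).
Proof.
rewrite /dual_sum; elim: k => [|k IH] in nu z *.
  by under eq_fun do rewrite big_ord0; by move=> x; exact: cvg_cst.
under eq_fun do rewrite big_ord_recl.
move=> x; apply: cvgD; last exact: (IH _ (fun i => z (lift ord0 i))).
by apply: cvgZl_tmp; exact: cts_fun.
Qed.

HB.instance Definition _ k nu (z : 'I_k -> dual E) :=
  GRing.isLinear.Build R E R^o *:%R (dual_sum nu z) (dual_sum_linear nu z).
HB.instance Definition _ k nu (z : 'I_k -> dual E) :=
  isContinuous.Build E R^o (dual_sum nu z) (@dual_sum_continuous k nu z).

(** Its adjoint restricts functionals on E * R to the first factor. *)
Definition slice : E -> E * R^o := fun y => (y, 0).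

Fact slice_linear : linear slice.
Proof. by move=> a x y; congr (_, _); rewrite /= scaler0 addr0. Qed.

Fact slice_continuous : continuous slice.
Proof.
move=> x; apply: (@cvg_pair _ _ _ _ (nbhs x) (nbhs (0 : R^o))).
- exact: cvg_id.
- exact: cvg_cst.
Qed.

HB.instance Definition _ :=
  GRing.isLinear.Build R E (E * R^o)%type *:%R slice slice_linear.
HB.instance Definition _ :=
  isContinuous.Build E (E * R^o)%type slice slice_continuous.

Lemma functional_prodE (u : dual (E * R^o)%type) y (r : R) :
  u (y, r) = adjoint slice u y + r * u (0, 1).
Proof.
have -> : (y, r) = slice y + r *: (0, 1) :> E * R^o.
  by congr (_, _); rewrite /= ?scaler0 ?addr0 // add0r /GRing.scale /= mulr1.
by rewrite linearD linearZ.
Qed.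

(** u - u x0 is nonnegative on the cone generated by C - x0, hence on its closure;
the latter is a linear subspace, so it contains - (x - x0) for each x in C. *)
Lemma qri_no_support (C : set E) x0 (u : dual E) : qri C x0 ->
  (forall x, C x -> (u x0 : R) <= u x) -> forall x, C x -> u x = u x0.
Proof.
move=> [Cx0 [L0 Llin]] ux0 x Cx.
set K := cone _ in L0 Llin.
have K_ge0 : closure K `<=` [set y | 0 <= (u y : R)].
  have /closure_id -> : closed [set y | 0 <= (u y : R)].
    apply: (@preimage_closed _ R^o u [set s | 0 <= s]); last exact: closed_ge.
    by move=> y _; exact: cts_fun.
  apply: closureS => _ [t /= t0 [_ [y Cy <-] <-]].
  by rewrite /= linearZ linearB mulr_ge0 // subr_ge0 ux0.
have Kx : closure K (x - x0).
  apply: subset_closure; exists 1 => //=.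
  by exists (x - x0); [exists x|rewrite scale1r].
have : (-1 *: (x - x0) + 0) \in [pred y | y \in closure K].
  by apply: Llin => //; exact: (mem_set Kx).
rewrite addr0 scaleN1r => /set_mem/K_ge0 /=.
rewrite linearN linearB oppr_ge0 subr_le0 => le.
by apply/le_anti; rewrite ux0 // andbT.
Qed.

End dual_constructions.

(** * Fenchel duality *)

Section duality.
Variables (R : realType) (X Y : tvsType R).
Variables (f : X -> \bar R) (g : Y -> \bar R) (A : linContType X Y).

Local Open Scope ereal_scope.

Lemma fenchel_young (E : tvsType R) (h : E -> \bar R) (u : dual E) x :
  (u x : R)%:E - h x <= conjugate h u.
Proof.
by apply: le_ereal_sup_tmp; exists ((u x : R)%:E - h x) => //; exists x.
Qed.

Lemma edom_fin (E : tvsType R) (h : E -> \bar R) x :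
  eproper h -> edom h x -> (fine (h x))%:E = h x.
Proof. by move=> [hN _] hx; rewrite fineK // fin_numE hN lt_eqF. Qed.

Lemma conjugate_le (E : tvsType R) (h : E -> \bar R) (u : dual E) (r : R) :
  eproper h -> (forall x, edom h x -> (u x - fine (h x) <= r :> R)%R) ->
  conjugate h u <= r%:E.
Proof.
move=> hp le; apply/ereal_supP => _ [x _ <-].
have [hx|] := ltP (h x) +oo.
  by rewrite -(edom_fin hp hx) lee_fin le.
by rewrite leye_eq => /eqP ->; rewrite leNye.
Qed.

Lemma weak_duality : eproper f -> eproper g ->
  dual_value f g A <= primal_value f g A.
Proof.
move=> fp gp; apply/ereal_supP => _ [v _ <-]; apply/ereal_infP => _ [x _ <-].
have [fx|] := ltP (f x) +oo; last first.
  by rewrite leye_eq => /eqP ->; rewrite addye ?leey // gp.1.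
have [gx|] := ltP (g (A x)) +oo; last first.
  by rewrite leye_eq => /eqP ->; rewrite addey ?leey // fp.1.
rewrite /dual_objective.
have := fenchel_young f (adjoint A v) x.
have := fenchel_young g (dual_opp v) (A x).
rewrite -(edom_fin fp fx) -(edom_fin gp gx).
set a := fine _; set b := fine _ => /=.
case: (conjugate g _) => [cg| |]; case: (conjugate f _) => [cf| |] //= gy fy.
2-4: by rewrite ?addNye ?addeNy leNye.
move: gy fy; rewrite -!EFinD !lee_fin /dual_opp /adjoint /= => ? ?; lra.
Qed.

Lemma primal_lt_oo x : edom f x -> edom g (A x) -> primal_value f g A < +oo.
Proof.
move=> fx gx; apply: (@le_lt_trans _ _ (f x + g (A x))).
  2: exact: lte_add_pinfty.
by apply: ge_ereal_inf; exists (f x + g (A x)) => //; exists x.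
Qed.

Lemma convex_on_epi_objective : eproper f -> econvex f ->
  convex_on [set w : X * R^o | edom f w.1] (fun w => (fine (f w.1) + w.2)%R).
Proof.
move=> fp fc [x r] [y s] t t01 /= fx fy.
have := fc x y t t01.
rewrite -(edom_fin fp fx) -(edom_fin fp fy) -!EFinM -EFinD => le.
have fz : edom f (t *: x + (1 - t) *: y)%R by exact: le_lt_trans le (ltry _).
split=> //; move: le; rewrite -(edom_fin fp fz) lee_fin => le.
have -> : (t *: (r : R^o) + (1 - t) *: (s : R^o) = t * r + (1 - t) * s :> R)%R.
  by [].
lra.
Qed.

(** The second factor being the whole line, a combination of the constraints that
is bounded below on dom f * R does not depend on it, and the claim is about a
functional on X. *)
Lemma no_support_qri k (z : 'I_k -> dual (Y * R^o)%type) (alpha : 'I_k -> R)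
    x0 (r0 : R) :
  qri (edom f) x0 ->
  no_support [set w : X * R^o | edom f w.1] (x0, r0)
    (fun i w => (z i (A w.1, w.2) : R) - alpha i)%R.
Proof.
move=> qx0.
set c := (X in no_support _ _ X); move=> nu.
set u := adjoint A (adjoint (@slice R Y) (dual_sum nu z)).
set b : R := dual_sum nu z (0, 1)%R.
have cE x r :
    (combination nu c (x, r) = u x + r * b - \sum_i nu i * alpha i :> R)%R.
  rewrite -[(u x + _)%R]functional_prodE /combination -sumrB.
  by apply: eq_bigr => i _; rewrite mulrBr.
move=> le.
have fx0 : edom f x0 by have [] := qx0.
have b0 : b = 0%R.
  have := le (x0, r0 + 1)%R fx0; have := le (x0, r0 - 1)%R fx0; rewrite !cE; lra.
have uP := @qri_no_support _ _ _ _ u qx0.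
move=> [x r] fx; rewrite !cE b0 !mulr0 uP // => y fy.
by have := le (y, r0) fy; rewrite !cE b0; lra.
Qed.

(** The Lagrange multipliers of the constraints describing epi g, combined into a
functional on Y, solve the dual problem. *)
Lemma dual_attained (p : R) : eproper f -> econvex f -> eproper g ->
  polyhedral g -> edom (g \o A) `&` qri (edom f) !=set0 ->
  primal_value f g A = p%:E ->
  exists v : dual Y, p%:E <= dual_objective f g A v.
Proof.
move=> fp fc gp [k [z [alpha epiE]]] [x0 [gx0 qx0]] pE.
have fx0 : edom f x0 by have [] := qx0.
have epiP y (r : R) : g y <= r%:E <-> (forall i, z i (y, r) <= alpha i :> R)%R.
  by have : epi g (y, r) <-> [set w | forall i, (z i w : R) <= alpha i]%R (y, r)
    by rewrite epiE.
pose c i (w : X * R^o) : R := ((z i (A w.1, w.2) : R) - alpha i)%R.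
pose r0 := fine (g (A x0)).
(* r0 = g (A x0) makes (x0, r0) feasible *)
have [i|i|w /= fw cw|mu mu0 muP] := @lagrange_multipliers _ _ k c _ _ (x0, r0) p
    (convex_on_epi_objective fp fc) _ fx0 _ (@no_support_qri k z alpha x0 r0 qx0).
- move=> w w' t; rewrite /c.
  have -> : (A (t *: w + (1 - t) *: w').1, (t *: w + (1 - t) *: w').2)%R =
    (t *: (A w.1, w.2) + (1 - t) *: (A w'.1, w'.2))%R :> Y * R^o.
    by rewrite /= linearP linearZ.
  rewrite linearP linearZ /= /GRing.scale /=; ring.
- rewrite /c subr_le0 /=; apply: (epiP _ _).1 => //.
  by rewrite /r0 (edom_fin gp).
- have gw : g (A w.1) <= w.2%:E.
    by apply/epiP => i; have := cw i; rewrite /c subr_le0.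
  rewrite -lee_fin -pE EFinD (edom_fin fp fw).
  apply: le_trans (leeD2l _ gw).
  by apply: ge_ereal_inf; exists (f w.1 + g (A w.1)) => //; exists w.1.
pose u : dual Y := adjoint (@slice R Y) (dual_sum mu z).
pose b : R := dual_sum mu z (0, 1)%R.
pose m : R := (\sum_i mu i * alpha i)%R.
have sE y (r : R) : (\sum_i mu i * (z i (y, r) : R) = u y + r * b :> R)%R.
  by rewrite -[RHS]functional_prodE.
have cE x r : (combination mu c (x, r) = u (A x) + r * b - m :> R)%R.
  rewrite -sE /combination -sumrB.
  by apply: eq_bigr => i _; rewrite mulrBr.
(* the Lagrangian is affine in r with slope 1 + b and bounded below *)
have b1 : b = (-1)%R.
  pose q : R := (fine (f x0) + (u (A x0) : R) - m - p)%R.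
  have qP (r : R) : (0 <= q + r * (1 + b))%R.
    by have := muP (x0, r) fx0; rewrite cE /= /q; lra.
  apply: contrapT => /eqP bN.
  have b0 : (1 + b)%R != 0%R by rewrite addrC addr_eq0.
  have := qP (- (q + 1) / (1 + b))%R; rewrite divfK //; lra.
exists (dual_opp u).
have fconj : conjugate f (adjoint A (dual_opp u)) <= (- (p + m))%:E.
  apply: conjugate_le => // x fx; rewrite /adjoint /dual_opp /=.
  by have := muP (x, 0%R) fx; rewrite cE /=; lra.
have gconj : conjugate g (dual_opp (dual_opp u)) <= m%:E.
  apply: conjugate_le => // y gy; rewrite /dual_opp /= opprK.
  have : (u y + fine (g y) * b <= m :> R)%R.
    rewrite -sE; apply: ler_sum => i _; rewrite ler_wpM2l //.
    by apply: (epiP _ _).1; rewrite (edom_fin gp).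
  by rewrite b1; lra.
rewrite /dual_objective.
have -> : p%:E = - (- (p + m))%:E - m%:E :> \bar R.
  by rewrite -!EFinN -EFinD; congr EFin; ring.
by apply: leeB; rewrite ?leeN2.
Qed.

End duality.

Theorem theorem6p7 (R : realType) (X Y : tvsType R)
    (f : X -> \bar R) (g : Y -> \bar R) (A : linContType X Y)
    (f_proper : eproper f) (f_convex : econvex f)
    (g_proper : eproper g) (g_convex : econvex g)
    (g_polyhedral : polyhedral g)
    (qualification : edom (g \o A) `&` qri (edom f) !=set0) :
  primal_value f g A = dual_value f g A /\
  (primal_value f g A \is a fin_num ->
   exists v : dual Y, dual_objective f g A v = dual_value f g A).
Proof.
have weak := weak_duality A f_proper g_proper.
have dual_ub v : (dual_objective f g A v <= dual_value f g A)%E.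
  by apply: le_ereal_sup_tmp; exists (dual_objective f g A v) => //; exists v.
have [x0 [gx0 [fx0 _]]] := qualification.
have := primal_lt_oo fx0 gx0.
case pE : (primal_value f g A) => [p| |] // _; last first.
  by split=> //; apply/esym/eqP; rewrite -leeNy_eq -pE.
have [v pv] :=
  dual_attained f_proper f_convex g_proper g_polyhedral qualification pE.
have dp : dual_value f g A = p%:E.
  by apply/le_anti; rewrite -{1}pE weak (le_trans pv).
split=> // _; exists v; apply/le_anti; rewrite dual_ub /=.
by rewrite dp.
Qed.
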